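(* Consider a multi-hop network with unicast flows $k=1,\dots,K$, each with a single fixed known path $p^k$ (a set of links) from its source to its destination. The multi-hop average age minimization problem over stationary randomized policies, given by $$\text{minimize over } \mathbf{x}\in\mathbb{X}\quad \sum_{k\in[K]}\sum_{e\in p^k}\frac{w^k}{\gamma_e f_e^k}\qquad\text{subject to } \mathbf{f}=M\mathbf{x},$$ can be viewed as an equivalent single-hop age problem, i.e. an equivalent problem of the form $$\text{minimize over } \mathbf{x}\in\mathbb{X}\quad \sum_{e\in E}\frac{w_e}{\gamma_e f_e}\qquad\text{subject to } \mathbf{f}=M\mathbf{x}.$$
   Context: Multi-hop network: a graph $G=(V,E)$ in slotted time carries $K$ flows, $[K]=\{1,\dots,K\}$. Flow $k$ has a source node $k$, a single destination node $d_k$, and a set $C_k$ of commissioned (forwarding) nodes that forms a single connected path from the source to $d_k$; $p^k$ is the set of all links on this path. $w^k$ is the constant weight of the age of flow $k$ at $d_k$ in the average weighted-sum age. The states of the links are independent across links and i.i.d. over time; $\gamma_e$ is the probability that the state of link $e$ is 1, i.e. that a scheduled interference-free transmission on $e$ succeeds. Feasible actions: $\mathcal{A}$ is the set of all interference-free choices of links together with the flows transmitted on them; each $m\in\mathcal{A}$ specifies a subset of links and the corresponding flows that can be sent on these links in a single slot without interference. Stationary randomized policies: $\mathbb{X}$ is the set of probability vectors $\mathbf{x}=(x_m)_{m\in\mathcal{A}}$, $\sum_{m\in\mathcal{A}}x_m=1$; in each slot, independently across slots, action $m$ is used with probability $x_m$. The link activation frequency $f_e^k$ of link $e$ for flow $k$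 is the probability that a transmission of an update of flow $k$ on link $e$ is attempted in a slot, that is, $f_e^k=\sum x_m$, the sum being over the actions $m\in\mathcal{A}$ in which a flow-$k$ update is transmitted on $e$. This linear relation is written $\mathbf{f}=M\mathbf{x}$. The objective of the multi-hop problem is the weighted average age at the destinations under the policy. Single-hop age problem: the weighted average age minimization problem for a single-hop network with general interference constraints in which multiple nodes send their own updates to a base station. Each edge $e$ connects one node to the base station and carries only that node's updates, so the link activation frequency is written simply $f_e$; $w_e$ is the weight and $\gamma_e$ the reliability (probability that the link state is 1) of edge $e$. In this problem $E$, $\mathbb{X}$ and $M$ refer to the edges, the probability vectors over feasible actions, and the induced linear map from action probabilities to link activation frequencies of the single-hop network. *)

(* Defs.v *)
From HB Require Import structures.
From mathcomp Require Import all_boot all_order all_algebra.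
From mathcomp Require Import all_classical all_reals all_analysis.
Set Implicit Arguments.
Unset Strict Implicit.
Unset Printing Implicit Defensive.
Import Order.TTheory GRing.Theory Num.Theory.
Local Open Scope classical_set_scope.
Local Open Scope ring_scope.

Section Randomized.
Context {R : realType}.

Definition policies (A : finType) : set {ffun A -> R} :=
  [set x | (forall m, 0 <= x m) /\ \sum_m x m = 1].

Definition push_policy (A B : finType) (phi : A -> B) (x : {ffun A -> R}) :
  {ffun B -> R} := [ffun n => \sum_(m | phi m == n) x m].

(* The outcome of a slot: the action used and the state of every link. *)
Definition outcome (A L : finType) : finType := (A * {ffun L -> bool})%type.

Definition outcome_prob (A L : finType) (x : {ffun A -> R}) (gamma : L -> R)
    (o : outcome A L) : R :=
  x o.1 * \prod_e (if o.2 e then gamma e else 1 - gamma e).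

(* Expectation of a quantity g that depends on the first t slots, which are
   i.i.d. with distribution mu. *)
Definition expected (O : finType) (mu : O -> R) (t : nat) (g : seq O -> nat) :
  R := \sum_(h : t.-tuple O) (\prod_(o <- h) mu o) * (g h)%:R.

(* age h is the age after the slots h (listed chronologically). *)
Definition average_age (O : finType) (mu : O -> R) (age : seq O -> nat) :
  \bar R :=
  limn_esup (fun n => (arithmetic_mean (fun t => expected mu t age) n)%:E).

End Randomized.

(* A directed graph; an undirected one has both orientations of each link.
   route k lists the nodes of the path of flow k that come after its source. *)
Record multihop (R : realType) := Multihop {
  node : finType;
  graph : rel node;
  nflows : nat;
  source : 'I_nflows -> node;
  source_inj : injective source;
  dest : 'I_nflows -> node;
  route : 'I_nflows -> seq node;
  route_path : forall k, path graph (source k) (route k);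
  route_uniq : forall k, uniq (source k :: route k);
  route_last : forall k, last (source k) (route k) = dest k;
  weight : 'I_nflows -> R;
  weight_ge0 : forall k, 0 <= weight k;
  reliability : {e : node * node | graph e.1 e.2} -> R;
  reliability_ge0 : forall e, 0 <= reliability e;
  reliability_le1 : forall e, reliability e <= 1;
  (* The argument tells which flow, if any, is transmitted on each link. *)
  interference_free :
    pred {ffun {e : node * node | graph e.1 e.2} -> option 'I_nflows} }.

Section MultihopNetwork.
Context {R : realType} (N : multihop R).

Definition link : finType := {e : node N * node N | graph e.1 e.2}.
Definition flow : finType := 'I_(nflows N).

Definition route_links (k : flow) : {set link} :=
  [set e : link | val e \in zip (source k :: route k) (route k)]%SET.

Definition feasible_action : pred {ffun link -> option flow} := fun m =>
  interference_free m &&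
  [forall e, forall k, (m e == Some k) ==> (e \in route_links k)].

Definition flow_action : finType :=
  {m : {ffun link -> option flow} | feasible_action m}.

Definition transmits (m : flow_action) (e : link) (k : flow) : bool :=
  val m e == Some k.

Definition frequency (x : {ffun flow_action -> R}) (e : link) (k : flow) : R :=
  \sum_(m | transmits m e k) x m.

Definition delivers (o : outcome flow_action link) (e : link) (k : flow) :
  bool :=
  transmits o.1 e k && o.2 e.

(* Ages of flow k at all nodes after one more slot.  Every node forwards the
   freshest update it had at the beginning of the slot, and the source always
   has an update of age 0. *)
Definition age_step (k : flow) (a : {ffun node N -> nat})
    (o : outcome flow_action link) : {ffun node N -> nat} :=
  [ffun v => if v == source k then 0%N else
    (\big[minn/a v]_(e : link | delivers o e k && ((val e).2 == v))
        a (val e).1).+1].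

Definition dest_age (k : flow) (h : seq (outcome flow_action link)) : nat :=
  foldl (age_step k) [ffun=> 0%N] h (dest k).

Definition weighted_age (x : {ffun flow_action -> R}) : \bar R :=
  (\sum_(k : flow) (weight k)%:E *
     average_age (outcome_prob x (@reliability R N)) (dest_age k))%E.

(* In \bar R, the inverse of 0 is +oo. *)
Definition multihop_cost (x : {ffun flow_action -> R}) : \bar R :=
  (\sum_(k : flow) \sum_(e in route_links k)
     (weight k)%:E / (reliability e * frequency x e k)%:E)%E.

Definition hop : finType := {h : link * flow | h.1 \in route_links h.2}.
Definition hop_link (h : hop) : link := (val h).1.
Definition hop_flow (h : hop) : flow := (val h).2.

End MultihopNetwork.

(* Each edge joins its own node to the base station. *)
Record singlehop (R : realType) := Singlehop {
  edge : finType;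
  edge_weight : edge -> R;
  edge_weight_ge0 : forall e, 0 <= edge_weight e;
  edge_reliability : edge -> R;
  edge_reliability_ge0 : forall e, 0 <= edge_reliability e;
  edge_reliability_le1 : forall e, edge_reliability e <= 1;
  edge_interference_free : pred {set edge} }.

Section SinglehopNetwork.
Context {R : realType} (S : singlehop R).

Definition edge_action : finType :=
  {m : {set edge S} | edge_interference_free m}.

Definition edge_frequency (x : {ffun edge_action -> R}) (e : edge S) : R :=
  \sum_(m : edge_action | e \in val m) x m.

Definition edge_age_step (e : edge S) (a : nat)
    (o : outcome edge_action (edge S)) : nat :=
  if (e \in val o.1) && o.2 e then 1%N else a.+1.

Definition edge_age (e : edge S) (h : seq (outcome edge_action (edge S))) :
  nat := foldl (edge_age_step e) 0%N h.

Definition edge_weighted_age (x : {ffun edge_action -> R}) : \bar R :=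
  (\sum_(e : edge S) (edge_weight e)%:E *
     average_age (outcome_prob x (@edge_reliability R S)) (edge_age e))%E.

Definition singlehop_cost (x : {ffun edge_action -> R}) : \bar R :=
  (\sum_(e : edge S)
     (edge_weight e)%:E / (edge_reliability e * edge_frequency x e)%:E)%E.

End SinglehopNetwork.

Record problem (R : realType) := Problem {
  decision : Type;
  feasible : set decision;
  cost : decision -> \bar R }.

Arguments feasible {R}.
Arguments cost {R}.

Definition same_problem_via (R : realType) (P Q : problem R)
    (Phi : decision P -> decision Q) : Prop :=
  set_bij (feasible P) (feasible Q) Phi /\
  forall x, feasible P x -> cost Q (Phi x) = cost P x.

(* Each age problem minimizes the average age itself; its counterpart minimizes
   the closed form. *)
Definition multihop_age_problem (R : realType) (N : multihop R) :=
  Problem (@policies R (flow_action N)) (@weighted_age R N).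
Definition multihop_problem (R : realType) (N : multihop R) :=
  Problem (@policies R (flow_action N)) (@multihop_cost R N).
Definition singlehop_age_problem (R : realType) (S : singlehop R) :=
  Problem (@policies R (edge_action S)) (@edge_weighted_age R S).
Definition singlehop_problem (R : realType) (S : singlehop R) :=
  Problem (@policies R (edge_action S)) (@singlehop_cost R S).

(* Main.v *)
(* Along the route of a flow the ages increase, so after a slot the age at the
   head of a hop is 1 plus the age at its tail if the hop succeeds, which has
   probability q = gamma_e f_e independently of the past, and 1 plus its own age
   otherwise.  Hence E b' = 1 + q E a + (1 - q) E b.  Summing over time, the time average of
   E b is that of E a plus 1/q, up to an error (E b)/(q n) that vanishes because
   E b is bounded by the sum of the 1/q along the route (if some q is 0, then
   both sides are infinite).  The hops therefore
   contribute additively to the age, each as much as an edge of a single-hop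
   network: a hop whose tail always has age 0.  The single-hop network has one
   edge per hop and the images of the multi-hop actions as feasible sets. *)
Require Import Defs.
From HB Require Import structures.
From mathcomp Require Import all_boot all_order all_algebra.
From mathcomp Require Import all_classical all_reals all_analysis.
From mathcomp Require Import ring.

Set Implicit Arguments.
Unset Strict Implicit.
Unset Printing Implicit Defensive.

Import Order.TTheory GRing.Theory Num.Theory numFieldNormedType.Exports.
Local Open Scope classical_set_scope.
Local Open Scope ring_scope.

(** * Expectations and time averages over i.i.d. slots *)

Section Slots.
Context {R : realType} {O : finType} (mu : O -> R).
Hypotheses (mu_ge0 : forall o, 0 <= mu o) (mu_sum1 : \sum_o mu o = 1).
Implicit Types (t : nat) (A B : seq O -> nat) (L : \bar R).

Lemma eq_expected t A B : A =1 B -> expected mu t A = expected mu t B.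
Proof. by move=> AB; apply: eq_bigr => h _; rewrite AB. Qed.

Lemma expected0 A : expected mu 0 A = (A [::])%:R.
Proof.
rewrite /expected (big_pred1 [tuple]) /= ?big_nil ?mul1r // => h.
by apply/esym/eqP; rewrite (tuple0 h); exact: val_inj.
Qed.

(** The last slot is split off rather than the first, because ages are computed by [foldl], so that
    a new slot acts on the age reached before. *)
Lemma expectedS t A :
  expected mu t.+1 A = \sum_o mu o * expected mu t (fun h => A (rcons h o)).
Proof.
pose f (p : t.-tuple O * O) : t.+1.-tuple O := [tuple of rcons p.1 p.2].
have f_bij : bijective f.
  apply: inj_card_bij => [[h o] [h' o'] /(congr1 val)/= /rcons_inj[]|].
    by move=> /val_inj -> ->.
  by rewrite card_prod !card_tuple expnSr.
rewrite /expected (reindex f) /=; last exact: onW_bij.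
rewrite -(pair_bigA _ (fun (h : t.-tuple O) (o : O) =>
  (\prod_(o' <- rcons h o) mu o') * (A (rcons h o))%:R)) /= exchange_big /=.
apply: eq_bigr => o _; rewrite big_distrr /=; apply: eq_bigr => h _.
by rewrite big_rcons /= mulrA [mu o * _]mulrC.
Qed.

Lemma expected_cst t n : expected mu t (fun=> n) = n%:R.
Proof.
elim: t => [|t IHt]; first by rewrite expected0.
by rewrite expectedS -big_distrl /= mu_sum1 mul1r IHt.
Qed.

Lemma expectedD t A B :
  expected mu t (fun h => (A h + B h)%N) = expected mu t A + expected mu t B.
Proof. by rewrite -big_split; apply: eq_bigr => h _; rewrite natrD mulrDr. Qed.

Lemma expected_succ t A :
  expected mu t (fun h => (A h).+1) = 1 + expected mu t A.
Proof. by rewrite -[1](expected_cst t 1) -expectedD; apply: eq_expected. Qed.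

Lemma le_expected t A B :
  (forall h, (A h <= B h)%N) -> expected mu t A <= expected mu t B.
Proof.
move=> AB; apply: ler_sum => h _; apply: ler_wpM2l; last by rewrite ler_nat.
exact: prodr_ge0.
Qed.

Lemma expected_ge0 t A : 0 <= expected mu t A.
Proof. by rewrite -[0](expected_cst t 0); apply: le_expected. Qed.

(* The uniform bound makes E b / n vanish in the telescoped recursion; it says
   nothing when L = +oo. *)
Definition mean_age_cvg A L :=
  (forall t, (expected mu t A)%:E <= L)%E /\
  (arithmetic_mean ((expected mu)^~ A) n)%:E @[n --> \oo] --> L.

Lemma mean_age_cvg_average A L : mean_age_cvg A L -> average_age mu A = L.
Proof. by case=> _ /cvg_limn_einf_sup[]. Qed.

Lemma mean_age_cvg0 A : (forall h, A h = 0%N) -> mean_age_cvg A 0%E.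
Proof.
move=> A0; have EA t : expected mu t A = 0.
  by rewrite (@eq_expected t _ (fun=> 0%N)) // expected_cst.
split=> [t|]; first by rewrite EA.
apply: cvg_near_cst; apply: nearW => n; congr _%:E.
by rewrite /arithmetic_mean /= seriesEord /= big1 ?mulr0.
Qed.

Lemma arithmetic_mean_expected A n :
  arithmetic_mean ((expected mu)^~ A) n =
  n.+1%:R^-1 * \sum_(t < n.+1) expected mu t A.
Proof. by rewrite /arithmetic_mean /= seriesEord. Qed.

(* B is the age at the head of a hop whose tail has age A. *)
Section Hop.
Variables (A B : seq O -> nat) (d : pred O).
Hypotheses (B_nil : B [::] = 0%N) (leAB : forall h, (A h <= B h)%N).
Hypothesis B_rcons :
  forall h o, B (rcons h o) = (if d o then A h else B h).+1.

Let q : R := \sum_(o | d o) mu o.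
Local Notation EA t := (expected mu t A).
Local Notation EB t := (expected mu t B).

Let q_ge0 : 0 <= q. Proof. exact: sumr_ge0. Qed.
Let q_le1 : q <= 1.
Proof.
by rewrite -mu_sum1 [leRHS](bigID d) /= lerDl; apply: sumr_ge0.
Qed.

Lemma expected_hop t : EB t.+1 = 1 + q * EA t + (1 - q) * EB t.
Proof.
have qC : 1 - q = \sum_(o | ~~ d o) mu o.
  by rewrite -mu_sum1 (bigID d) /= addrC addrK.
rewrite expectedS -[X in _ = X + _ + _]mu_sum1 qC !big_distrl /=.
rewrite (big_mkcond d) (big_mkcond (fun o => ~~ d o)) -!big_split /=.
apply: eq_bigr => o _; rewrite (eq_expected t (B_rcons^~ o)).
by rewrite expected_succ; case: (d o) => /=; ring.
Qed.

(** Telescoping of [expected_hop], with [EB n] as the boundary term; not dividing by [q] keeps it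
    valid for [q = 0]. *)
Lemma sum_expected_hop n :
  q * (\sum_(t < n) EB t) = q * (\sum_(t < n) EA t) + n%:R - EB n.
Proof.
elim: n => [|n IHn].
  by rewrite !big_ord0 expected0 B_nil; ring.
by rewrite !big_ord_recr /= !mulrDr IHn expected_hop -natr1; ring.
Qed.

Lemma mean_age_cvg_hop L :
  mean_age_cvg A L -> mean_age_cvg B (L + q%:E^-1)%E.
Proof.
case=> EA_le meanA; have [q0|qN0] := eqVneq q 0.
  (* The bound on [EA 0] excludes [L = -oo], for which the sum would not be [+oo]. *)
  have -> : (L + q%:E^-1 = +oo)%E.
    rewrite q0 inve0 addey // gt_eqF // (lt_le_trans _ (EA_le 0)) // ltNye //.
  split=> [t|]; first exact: leey.
  (* The hop has probability 0 of succeeding, so the expected age is the elapsed time, and its mean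
     over the times 0 to [n] is [n / 2]. *)
  have EBE t : EB t = t%:R.
    elim: t => [|t IHt]; first by rewrite expected0 B_nil.
    by rewrite expected_hop q0 IHt -natr1; ring.
  have meanBE n : arithmetic_mean ((expected mu)^~ B) n = n%:R / 2.
    have sumE k : \sum_(t < k) EB t = k%:R * (k%:R - 1) / 2.
      elim: k => [|k IHk]; first by rewrite big_ord0; ring.
      by rewrite big_ord_recr /= IHk EBE -natr1; field.
    rewrite arithmetic_mean_expected sumE -natr1.
    by field; rewrite natr1.
  apply/cvgeryP; apply/cvgryPge => M.
  near=> n; rewrite meanBE ler_pdivlMr //; near: n.
  exact: (cvgry_ge cvgr_idn).
have q_gt0 : 0 < q by rewrite lt_def qN0.
have [Ly|Lfin] := eqVneq L +oo%E.
  have -> : (L + q%:E^-1 = +oo)%E by rewrite Ly inver (negPf qN0).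
  split=> [t|]; first exact: leey.
  (* The head is never younger than the tail, so its mean age diverges with that of the tail. *)
  rewrite {}Ly in meanA; apply: gee_cvgy meanA; apply: nearW => n.
  rewrite lee_fin !arithmetic_mean_expected ler_wpM2l ?invr_ge0 //.
  by apply: ler_sum => t _; apply: le_expected.
case: L EA_le meanA Lfin => [l| //|/(_ 0%N)//] EA_le meanA _.
rewrite inver (negPf qN0) -EFinD.
have EB_le t : EB t <= l + q^-1.
  have := EA_le 0; rewrite lee_fin => /(le_trans (expected_ge0 _ _)) l_ge0.
  elim: t => [|t IHt].
    by rewrite expected0 B_nil addr_ge0 ?invr_ge0.
  rewrite expected_hop.
  have {EA_le} EA_le := EA_le t; rewrite lee_fin in EA_le.
  (* [l + q^-1] is the fixed point of the recursion with [EA t] replaced by its bound [l], and the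
     recursion is monotone as [0 <= q <= 1]. *)
  have -> : l + q^-1 = 1 + q * l + (1 - q) * (l + q^-1) by field.
  by apply: lerD; [rewrite lerD2l|]; apply: ler_wpM2l; rewrite ?subr_ge0.
split=> [t|]; first by rewrite lee_fin.
(* This is [sum_expected_hop] at [n.+1], divided by [q * n.+1]; [harmonic n] is the inverse of
   [n.+1]. *)
have -> : (fun n => (arithmetic_mean ((expected mu)^~ B) n)%:E) =
    EFin \o (fun n => arithmetic_mean ((expected mu)^~ A) n +
     (q^-1 - harmonic n * EB n.+1 * q^-1)).
  apply/funext => n /=; congr _%:E; rewrite !arithmetic_mean_expected.
  have -> : \sum_(t < n.+1) EB t = q^-1 * (q * (\sum_(t < n.+1) EB t)).
    by rewrite mulKf.
  rewrite sum_expected_hop.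
  by field; rewrite qN0 addrC natr1 pnatr_eq0.
apply: cvg_EFin; first exact: nearW.
apply: cvgD; first by case/fine_cvgP: meanA.
rewrite -[X in _ --> X]subr0; apply: cvgB; first exact: cvg_cst.
(* The boundary term vanishes by the uniform bound [EB_le]. *)
apply: (@squeeze_cvgr _ _ _ _ (cst 0)
    (fun n => harmonic n * (l + q^-1) * q^-1)).
- apply: nearW => n /=; have ? : 0 <= EB n.+1 := expected_ge0 _ _.
  by rewrite !mulr_ge0 ?invr_ge0 // ler_wpM2r ?invr_ge0 // ler_wpM2l ?invr_ge0.
- exact: cvg_cst.
- have -> : 0 = 0 * (l + q^-1) * q^-1 :> R by rewrite !mul0r.
  by do 2![apply: cvgMr_tmp]; exact: cvg_harmonic.
Unshelve. all: by end_near. Qed.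

End Hop.
End Slots.

(** * The distribution of one slot *)

Section Outcomes.
Context {R : realType} (A L : finType) (x : {ffun A -> R}) (gamma : L -> R).
Hypothesis x_policy : policies x.
Hypotheses (gamma_ge0 : forall e, 0 <= gamma e)
  (gamma_le1 : forall e, gamma e <= 1).

Lemma outcome_prob_ge0 o : 0 <= outcome_prob x gamma o.
Proof.
apply: mulr_ge0; first by case: x_policy.
by apply: prodr_ge0 => e _; case: ifP; rewrite ?subr_ge0.
Qed.

Lemma sum_states :
  \sum_(s : {ffun L -> bool})
     \prod_e (if s e then gamma e else 1 - gamma e) = 1.
Proof.
rewrite -(bigA_distr_bigA (fun e (b : bool) =>
  if b then gamma e else 1 - gamma e)) big1 // => e _.
by rewrite big_bool /= addrC subrK.
Qed.

Lemma sum_states_link e :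
  \sum_(s : {ffun L -> bool} | s e)
     \prod_e' (if s e' then gamma e' else 1 - gamma e') = gamma e.
Proof.
(* [G] gives weight 0 to state 0 of [e]; this absorbs the condition [s e] into the product, so that
   sum and product can be exchanged. *)
pose G e' (b : bool) :=
  if b then gamma e' else if e' == e then 0 else 1 - gamma e'.
rewrite big_mkcond (eq_bigr (fun s : {ffun L -> bool} =>
  \prod_e' G e' (s e'))) => [|s _].
  rewrite -(bigA_distr_bigA G) (bigD1 e) //= big_bool /G eqxx /= addr0.
  rewrite big1 ?mulr1 // => e' /negPf ne; rewrite big_bool ne /=.
  by rewrite addrC subrK.
have [se|/negPf se] := boolP (s e).
  by apply: eq_bigr => e' _; rewrite /G; case: eqP => // ->; rewrite se.
by rewrite (bigD1 e) //= /G se eqxx mul0r.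
Qed.

Lemma outcome_prob_sum1 : \sum_o outcome_prob x gamma o = 1.
Proof.
rewrite -(pair_bigA _ (fun (m : A) (s : {ffun L -> bool}) =>
  x m * \prod_e (if s e then gamma e else 1 - gamma e))) /=.
under eq_bigr => m _ do rewrite -big_distrr /= sum_states mulr1.
by case: x_policy.
Qed.

(** Action and link states are independent; this yields the success probability [q] of a hop in both
    networks. *)
Lemma outcome_prob_success (a : pred A) e :
  \sum_(o : outcome A L | a o.1 && o.2 e) outcome_prob x gamma o =
  gamma e * \sum_(m | a m) x m.
Proof.
rewrite -(pair_big_dep _ (fun m (s : {ffun L -> bool}) => s e)
  (fun (m : A) (s : {ffun L -> bool}) =>
    x m * \prod_e (if s e then gamma e else 1 - gamma e))) /=.
under eq_bigr => m _ do rewrite -big_distrr /= sum_states_link.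
by rewrite -big_distrl mulrC.
Qed.

End Outcomes.

(** * Consecutive pairs of a path *)

Section PathLinks.
Context {T : eqType}.
Implicit Types (u v w : T) (s : seq T).

Lemma zip_cons_rcons w s v :
  zip (w :: rcons s v) (rcons s v) = rcons (zip (w :: s) s) (last w s, v).
Proof. by elim: s w => //= a s IHs w; rewrite -IHs. Qed.

Lemma mem_zip_cat w s1 v s2 :
  (last w s1, v) \in zip (w :: s1 ++ v :: s2) (s1 ++ v :: s2).
Proof.
by elim: s1 w => [|a s1 IHs] w /=; rewrite inE ?eqxx // IHs orbT.
Qed.

Lemma mem_zip_head u v w s : (u, v) \in zip (w :: s) s -> v \in s.
Proof.
elim: s w => //= a s IHs w; rewrite !inE => /orP[/eqP[_ ->]|/IHs ->].
  by rewrite eqxx.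
by rewrite orbT.
Qed.

(** A node that occurs once in [s] is entered by one link only; hence a single hop can refresh its
    age. *)
Lemma zip_head_inj u u' v w s :
  uniq s -> (u, v) \in zip (w :: s) s -> (u', v) \in zip (w :: s) s -> u = u'.
Proof.
elim: s w => //= a s IHs w /andP[aNs s_uniq]; rewrite !inE.
move=> /orP[/eqP[-> va]|uv] /orP[/eqP[-> va']|u'v] //; last exact: IHs uv u'v.
- by rewrite -va (mem_zip_head u'v) in aNs.
- by rewrite -va' (mem_zip_head uv) in aNs.
Qed.

End PathLinks.

Lemma transmits_route (R : realType) (N : multihop R) (m : flow_action N) e k :
  transmits m e k -> e \in route_links k.
Proof.
by case/andP: (valP m) => _ /forallP/(_ e)/forallP/(_ k)/implyP; apply.
Qed.

(** * Ages along a route *)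

Section Multihop.
Context {R : realType} (N : multihop R) (x : {ffun flow_action N -> R}).
Hypothesis x_policy : policies x.
Local Notation gamma := (@reliability R N).
Local Notation mu := (outcome_prob x gamma).

(** Extends [dest_age] to all nodes, for the induction along the route. *)
Definition node_age (k : flow N) (v : node N)
    (h : seq (outcome (flow_action N) (link N))) : nat :=
  foldl (@age_step R N k) [ffun=> 0%N] h v.

Lemma node_age_source k h : node_age k (source k) h = 0%N.
Proof.
case/lastP: h => [|h o]; first by rewrite /node_age /= ffunE.
by rewrite /node_age foldl_rcons ffunE eqxx.
Qed.

Lemma node_age_rcons_le k v h o :
  (node_age k v (rcons h o) <= (node_age k v h).+1)%N.
Proof.
rewrite /node_age foldl_rcons ffunE; case: ifP => // _; rewrite ltnS.
by elim/big_rec: _ => // e n _ le_n; apply: leq_trans (geq_minr _ _) le_n.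
Qed.

Section RouteHop.
Variables (k : flow N) (s1 s2 : seq (node N)) (v : node N).
Hypothesis routeE : route k = s1 ++ v :: s2.
Variable e0 : link N.
Hypothesis e0E : val e0 = (last (source k) s1, v).
Local Notation u := (last (source k) s1).

Lemma route_hop_link : e0 \in route_links k.
Proof.
by rewrite inE e0E routeE mem_zip_cat.
Qed.

Lemma node_age_hop h o : v != source k ->
  node_age k v (rcons h o) =
  (if delivers o e0 k then minn (node_age k u h) (node_age k v h)
   else node_age k v h).+1.
Proof.
move=> vNs; rewrite /node_age foldl_rcons ffunE (negPf vNs).
set a := foldl _ _ _; congr _.+1.
(* Flow [k] is transmitted only on its route, whose only link into [v] is [e0], so the minimum in
   [age_step] has at most one term besides [a v]. *)
have delivE e : delivers o e k && ((val e).2 == v) =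
                (e == e0) && delivers o e0 k.
  have [->|eN] := eqVneq e e0; first by rewrite e0E eqxx andbT.
  apply/negP => /andP[/andP[/transmits_route e_route _] /eqP ev]; case/eqP: eN.
  have := route_hop_link; rewrite !inE in e_route *.
  have /= /andP[_ r_uniq] := route_uniq k.
  rewrite e0E => /(zip_head_inj r_uniq) E; apply: val_inj.
  by rewrite e0E (E (val e).1) -ev -?surjective_pairing.
rewrite (eq_bigl _ _ delivE); case: (delivers o e0 k).
  by under eq_bigl do rewrite andbT; rewrite big_pred1_eq_id e0E.
by under eq_bigl do rewrite andbF; rewrite big_pred0_eq.
Qed.

(** By induction on the slots: the new age of the head is 1 plus an old age at least that of the
    tail, and the tail ages by at most 1. It makes the [minn] of [node_age_hop] the age of the
    tail. *)
Lemma node_age_hop_le h : (node_age k u h <= node_age k v h)%N.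
Proof.
have [vs|vNs] := eqVneq v (source k).
  have := route_uniq k.
  by rewrite /= routeE -vs mem_cat inE eqxx orbT.
elim/last_ind: h => [|h o IH]; first by rewrite /node_age !ffunE.
rewrite node_age_hop //; apply: leq_trans (node_age_rcons_le k u h o) _.
by rewrite ltnS; case: ifP; rewrite ?leq_min ?leqnn.
Qed.

End RouteHop.

Definition hop_cost (e : link N) (k : flow N) : \bar R :=
  ((gamma e * frequency x e k)%:E^-1)%E.

Lemma hop_cost_ge0 e k : (0 <= hop_cost e k)%E.
Proof.
rewrite inve_ge0 lee_fin mulr_ge0 ?reliability_ge0 // sumr_ge0 // => m _.
by case: x_policy.
Qed.

(** Induction on the prefix [s1]: the source has age 0, and [mean_age_cvg_hop] adds the cost of each
    further hop. *)
Lemma node_age_cvg k s1 s2 : route k = s1 ++ s2 ->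
  mean_age_cvg mu (node_age k (last (source k) s1))
    (\sum_(e : link N | val e \in zip (source k :: s1) s1) hop_cost e k)%E.
Proof.
have mu_ge0 : forall o, 0 <= mu o.
  apply: outcome_prob_ge0 => //; first exact: reliability_ge0.
  exact: reliability_le1.
have mu_sum1 : \sum_o mu o = 1 by exact: outcome_prob_sum1.
elim/last_ind: s1 s2 => [|s1 v IHs1] s2.
  move=> _; rewrite big1 //=; apply: mean_age_cvg0 => // h.
  exact: node_age_source.
rewrite cat_rcons last_rcons => routeE; set u := last (source k) s1.
have uv : graph u v.
  by have := route_path k; rewrite routeE cat_path => /and3P[].
pose e0 : link N := exist _ (u, v) uv.
(* As the route has no repeated node, the link into [v] is a new term of the sum. *)
have uvN : (u, v) \notin zip (source k :: s1) s1.
  apply/negP => /mem_zip_head vs1; have := route_uniq k.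
  by rewrite /= routeE cat_uniq => /andP[_ /and3P[_ /norP[]]]; rewrite vs1.
have -> : (\sum_(e : link N | val e \in zip (source k :: rcons s1 v) (rcons s1 v))
              hop_cost e k =
           \sum_(e : link N | val e \in zip (source k :: s1) s1) hop_cost e k +
           hop_cost e0 k)%E.
  rewrite zip_cons_rcons (bigD1 e0) /=; last by rewrite mem_rcons inE eqxx.
  rewrite addeC; congr (_ + _)%E; apply: eq_bigl => e.
  rewrite mem_rcons inE -[_ == (u, v)]/(e == e0).
  have [->|] := eqVneq e e0; last by rewrite andbT.
  by rewrite andbF; apply/esym/negbTE.
have q : gamma e0 * frequency x e0 k = \sum_(o | delivers o e0 k) mu o.
  by rewrite [RHS](outcome_prob_success x gamma (fun m => transmits m e0 k) e0).
rewrite /hop_cost [in X in _ (_ + X)%E]q.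
have e0E : val e0 = (u, v) by [].
have le_uv := node_age_hop_le routeE e0E.
apply: (@mean_age_cvg_hop _ _ _ _ _ (node_age k u)) => //.
- by rewrite /node_age ffunE.
- move=> h o; rewrite (node_age_hop routeE e0E); last first.
    apply/eqP => vs; have := route_uniq k.
    by rewrite /= routeE -vs mem_cat inE eqxx orbT.
  by rewrite (minn_idPl (le_uv h)).
- exact: IHs1 routeE.
Qed.

Lemma weighted_ageE : weighted_age x = multihop_cost x.
Proof.
apply: eq_bigr => k _.
have cvg_dest := @node_age_cvg k (route k) [::] (esym (cats0 _)).
rewrite route_last in cvg_dest.
have -> : average_age mu (@dest_age _ _ k) =
    (\sum_(e in route_links k) hop_cost e k)%E.
  rewrite (mean_age_cvg_average cvg_dest).
  by apply: eq_bigl => e; rewrite inE.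
(* The weight distributes over a sum of possibly infinite costs because these are nonnegative. *)
by rewrite ge0_sume_distrr // => e _; exact: hop_cost_ge0.
Qed.

End Multihop.

Lemma edge_weighted_ageE (R : realType) (S : singlehop R)
    (x : {ffun edge_action S -> R}) :
  policies x -> edge_weighted_age x = singlehop_cost x.
Proof.
move=> x_policy; apply: eq_bigr => e _; congr (_ * _)%E.
have mu_ge0 := outcome_prob_ge0 x_policy
  (@edge_reliability_ge0 R S) (@edge_reliability_le1 R S).
have mu_sum1 := outcome_prob_sum1 (@edge_reliability R S) x_policy.
apply: mean_age_cvg_average; rewrite /edge_frequency.
rewrite -(outcome_prob_success _ _ (fun m : edge_action S => e \in val m)).
rewrite -[X in mean_age_cvg _ _ X]add0e.
apply: (@mean_age_cvg_hop _ _ _ _ _ (fun=> 0%N)) => //.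
- by move=> h o; rewrite /edge_age foldl_rcons {1}/edge_age_step; case: ifP.
- exact: mean_age_cvg0.
Qed.

(** * Transport of policies along a bijection of actions *)

Section PushPolicy.
Context {R : realType} (A B : finType) (phi : A -> B).
Hypothesis phi_bij : bijective phi.

Lemma push_policyE (x : {ffun A -> R}) m : push_policy phi x (phi m) = x m.
Proof.
rewrite ffunE (big_pred1 m) // => m' /=.
by apply/eqP/eqP => [/(bij_inj phi_bij)|->].
Qed.

Lemma sum_push_policy (x : {ffun A -> R}) (P : pred B) :
  \sum_(n | P n) push_policy phi x n = \sum_(m | P (phi m)) x m.
Proof.
rewrite (reindex phi) /=; last exact: onW_bij.
by apply: eq_bigr => m _; rewrite push_policyE.
Qed.

Lemma push_policy_bij :
  set_bij (@policies R A) (@policies R B) (push_policy phi).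
Proof.
split.
- move=> x [x_ge0 x_sum1]; split; last by rewrite sum_push_policy.
  by move=> n; rewrite ffunE sumr_ge0.
- move=> x y _ _ xy; apply/ffunP => m.
  by rewrite -(push_policyE x) xy push_policyE.
- move=> y [y_ge0 y_sum1]; exists [ffun m => y (phi m)].
    split=> [m|]; first by rewrite ffunE.
    rewrite -[RHS]y_sum1 [RHS](reindex phi) /=; last exact: onW_bij.
    by apply: eq_bigr => m _; rewrite ffunE.
  have [phi' _ phi'K] := phi_bij.
  by apply/ffunP => n; rewrite -[n]phi'K push_policyE ffunE.
Qed.

End PushPolicy.

(** * The single-hop network whose edges are the hops *)

Section EquivalentSinglehop.
Context {R : realType} (N : multihop R).

Definition hop_set (m : flow_action N) : {set hop N} :=
  [set h | transmits m (hop_link h) (hop_flow h)]%SET.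

(** Allowing exactly the images makes [hop_action] onto. *)
Definition hop_interference_free : pred {set hop N} :=
  fun s => s \in codom hop_set.

Definition hop_network : singlehop R := {|
  edge := hop N;
  edge_weight := fun h => weight (hop_flow h);
  edge_weight_ge0 := fun h => weight_ge0 (hop_flow h);
  edge_reliability := fun h => reliability (hop_link h);
  edge_reliability_ge0 := fun h => reliability_ge0 (hop_link h);
  edge_reliability_le1 := fun h => reliability_le1 (hop_link h);
  edge_interference_free := hop_interference_free |}.

Lemma hop_set_feasible m : hop_interference_free (hop_set m).
Proof. exact: codom_f. Qed.

Definition hop_action (m : flow_action N) : edge_action hop_network :=
  exist _ (hop_set m) (hop_set_feasible m).

(** Injective because a feasible action transmits a flow only on its route: each transmission is a
    hop, so [hop_set] loses none. *)
Lemma hop_action_bij : bijective hop_action.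
Proof.
have hop_inj : injective hop_action.
  move=> m m' /(congr1 val)/= mm'.
  have sub (n n' : flow_action N) e k : hop_set n = hop_set n' ->
      val n e = Some k -> val n' e = Some k.
    move=> nn' /eqP nek; have ek := transmits_route nek.
    pose h : hop N := exist _ (e, k) ek.
    have : h \in hop_set n by rewrite inE.
    by rewrite nn' inE => /eqP.
  apply/val_inj/ffunP => e.
  case Em: (val m e) => [k|]; first by rewrite (sub _ _ _ _ mm' Em).
  case Em': (val m' e) => [k|//].
  by rewrite (sub _ _ _ _ (esym mm') Em') in Em.
apply: (inj_card_bij hop_inj).
rewrite -(card_codom hop_inj).
apply/subset_leq_card/fintype.subsetP => -[s s_free] _.
have /codomP[m sE] := s_free.
apply/codomP; exists m; exact: val_inj.
Qed.

Lemma hop_frequency (x : {ffun flow_action N -> R}) (h : hop N) :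
  edge_frequency (S := hop_network) (push_policy hop_action x) h =
  frequency x (hop_link h) (hop_flow h).
Proof.
rewrite /edge_frequency (sum_push_policy hop_action_bij _
  (fun n : edge_action hop_network => h \in val n)).
by apply: eq_bigl => m; rewrite inE.
Qed.

Lemma hop_network_cost (x : {ffun flow_action N -> R}) :
  singlehop_cost (push_policy hop_action x) = multihop_cost x.
Proof.
(* The sums are exchanged because a hop lists its link before its flow; the pairs summed over then
   form the subtype [hop N]. *)
rewrite /multihop_cost (exchange_big_dep xpredT) //=.
rewrite pair_big_dep /=.
rewrite (big_sub (fun h : link N * flow N => h.1 \in route_links h.2)).
by apply: eq_bigr => h _; rewrite hop_frequency.
Qed.

End EquivalentSinglehop.

Theorem lemma2 (R : realType) (N : multihop R) :
  @same_problem_via R (multihop_age_problem N) (multihop_problem N) id /\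
  exists (S : singlehop R) (psi : hop N -> edge S)
         (phi : flow_action N -> edge_action S),
    [/\ bijective psi,
        bijective phi,
        (forall h : hop N,
           edge_weight (psi h) = weight (hop_flow h) /\
           edge_reliability (psi h) = reliability (hop_link h)),
        (forall (m : flow_action N) (h : hop N),
           (psi h \in val (phi m)) = transmits m (hop_link h) (hop_flow h)) &
        (forall x : {ffun flow_action N -> R}, policies x ->
           forall h : hop N,
           edge_frequency (push_policy phi x) (psi h) =
           frequency x (hop_link h) (hop_flow h))] /\
    [/\ @same_problem_via R (singlehop_age_problem S) (singlehop_problem S) id,
        @same_problem_via R (multihop_problem N) (singlehop_problem S)
          (push_policy phi) &
        @same_problem_via R (multihop_age_problem N) (singlehop_age_problem S)
          (push_policy phi)].
Proof.
have id_bij (T : Type) (D : set T) : set_bij D D id.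
  by split=> // y Dy; exists y.
have phi_bij := push_policy_bij (R := R) (@hop_action_bij R N).
split; first by split=> // x x_policy /=; rewrite weighted_ageE.
exists (hop_network N), id, (@hop_action R N); split.
  split=> //; first by exists id.
  - exact: hop_action_bij.
  - by move=> m h; rewrite inE.
  - by move=> x _ h; exact: hop_frequency.
split; split=> // x x_policy /=.
- by rewrite edge_weighted_ageE.
- exact: hop_network_cost.
(* The two average ages are compared through their closed forms; on the single-hop side this
   requires the pushed vector to be a policy. *)
- rewrite edge_weighted_ageE ?weighted_ageE ?hop_network_cost //.
  by case: phi_bij => + _ _; exact.
Qed.
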